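(* Let $R$ be a ring and $G$ a group. If the group ring $RG$ is a UU ring, then $R$ is a UU ring and $G$ is a $2$-group. The converse holds if $G$ is locally finite; that is, if $G$ is a locally finite $2$-group and $R$ is a UU ring, then $RG$ is a UU ring.
   Context: Rings are associative with identity, not necessarily commutative. A ring $S$ is a UU ring if $U(S)=1+{\rm Nil}(S)$, where $U(S)$ is the unit group and ${\rm Nil}(S)$ the set of nilpotent elements of $S$. $RG$ is the group ring of $G$ over $R$. A group is a $2$-group if the order of each of its elements is a (finite) power of $2$; it is locally finite if each of its finitely generated subgroups is finite. *)

(* Defs.v *)
From HB Require Import structures.
From mathcomp Require Import all_boot all_algebra.
From mathcomp Require Import finmap monalg.

Set Implicit Arguments.
Unset Strict Implicit.
Unset Printing Implicit Defensive.

Import GRing.Theory.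

Local Open Scope fset_scope.
Local Open Scope ring_scope.

(* The carrier is the additive group {malg R[G]} of finitely supported         *)
(* functions G -> R: a@_g is the coefficient of a at g, msupp a its support,   *)
(* and << r *g g >> the element r g.  The ring structure of {malg R[K]}        *)
(* requires K : monomType, in which 1 is the only unit, so it does not apply   *)
(* to groups; hence the alias below, which is given the convolution product.   *)
Definition group_ring (R : nzRingType) (G : groupType) : Type := {malg R[G]}.

HB.instance Definition _ (R : nzRingType) (G : groupType) :=
  GRing.Zmodule.copy (group_ring R G) {malg R[G]}.

Section GroupRing.
Variables (R : nzRingType) (G : groupType).
Implicit Types (a b : {malg R[G]}) (g h : G).

Definition gr_one : {malg R[G]} := << 1 *g (1%g : G) >>.

Definition gr_mul a b : {malg R[G]} :=
  \sum_(g <- msupp a) \sum_(h <- msupp b) << a@_g * b@_h *g (g * h)%g >>.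

Lemma gr_mul_widen (A B : {fset G}) a b :
    msupp a `<=` A -> msupp b `<=` B ->
  gr_mul a b = \sum_(g <- A) \sum_(h <- B) << a@_g * b@_h *g (g * h)%g >>.
Proof.
move=> sA sB; rewrite /gr_mul (big_fset_incl _ sA) /=.
  apply/eq_bigr=> g _; apply/big_fset_incl => // h _ /mcoeff_outdom ->.
  by rewrite mulr0 monalgU0.
move=> g _ /mcoeff_outdom ag.
by rewrite big1 // => h _; rewrite ag mul0r monalgU0.
Qed.

Lemma gr_mulUU (r s : R) g h :
  gr_mul << r *g g >> << s *g h >> = << r * s *g (g * h)%g >>.
Proof. by rewrite (gr_mul_widen msuppU_le msuppU_le) !big_seq_fset1 !mcoeffUU. Qed.

Lemma gr_mul0l : left_zero 0 gr_mul.
Proof. by move=> a; rewrite /gr_mul msupp0 big_seq_fset0. Qed.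

Lemma gr_mul0r : right_zero 0 gr_mul.
Proof. by move=> a; rewrite /gr_mul big1 // => g _; rewrite msupp0 big_seq_fset0. Qed.

Lemma gr_mulDl : left_distributive gr_mul +%R.
Proof.
move=> a b c.
rewrite (gr_mul_widen (msuppD_le a b) (fsubset_refl (msupp c))).
rewrite (gr_mul_widen (fsubsetUl _ (msupp b)) (fsubset_refl (msupp c))).
rewrite (gr_mul_widen (fsubsetUr (msupp a) _) (fsubset_refl (msupp c))).
rewrite -big_split /=; apply/eq_bigr=> g _.
rewrite -big_split /=; apply/eq_bigr=> h _.
by rewrite mcoeffD mulrDl monalgUD.
Qed.

Lemma gr_mulDr : right_distributive gr_mul +%R.
Proof.
move=> a b c.
rewrite (gr_mul_widen (fsubset_refl (msupp a)) (msuppD_le b c)).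
rewrite (gr_mul_widen (fsubset_refl (msupp a)) (fsubsetUl _ (msupp c))).
rewrite (gr_mul_widen (fsubset_refl (msupp a)) (fsubsetUr (msupp b) _)).
rewrite -big_split /=; apply/eq_bigr=> g _.
rewrite -big_split /=; apply/eq_bigr=> h _.
by rewrite mcoeffD mulrDr monalgUD.
Qed.

Lemma gr_mul_suml (I : Type) (r : seq I) (F : I -> {malg R[G]}) b :
  gr_mul (\sum_(i <- r) F i) b = \sum_(i <- r) gr_mul (F i) b.
Proof. exact: (big_morph (gr_mul^~ b) (fun _ _ => gr_mulDl _ _ _) (gr_mul0l _)). Qed.

Lemma gr_mul_sumr (I : Type) (r : seq I) (F : I -> {malg R[G]}) a :
  gr_mul a (\sum_(i <- r) F i) = \sum_(i <- r) gr_mul a (F i).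
Proof. exact: (big_morph (gr_mul a) (fun _ _ => gr_mulDr _ _ _) (gr_mul0r _)). Qed.

Lemma gr_mulA : associative gr_mul.
Proof.
move=> a b c; rewrite [a]monalgE !gr_mul_suml; apply/eq_bigr=> g _.
rewrite [b]monalgE !(gr_mul_suml, gr_mul_sumr); apply/eq_bigr=> h _.
rewrite [c]monalgE !gr_mul_sumr; apply/eq_bigr=> k _.
by rewrite !gr_mulUU mulrA mulgA.
Qed.

Lemma gr_mul1l : left_id gr_one gr_mul.
Proof.
move=> a; rewrite [a]monalgE gr_mul_sumr; apply/eq_bigr=> g _.
by rewrite gr_mulUU mul1r mul1g.
Qed.

Lemma gr_mul1r : right_id gr_one gr_mul.
Proof.
move=> a; rewrite [a]monalgE gr_mul_suml; apply/eq_bigr=> g _.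
by rewrite gr_mulUU mulr1 mulg1.
Qed.

Lemma gr_one_neq0 : gr_one != 0.
Proof. by rewrite monalgU_eq0 oner_neq0. Qed.

HB.instance Definition _ := GRing.Zmodule_isNzRing.Build (group_ring R G)
  gr_mulA gr_mul1l gr_mul1r gr_mulDl gr_mulDr gr_one_neq0.

End GroupRing.

(* GRing.unit is only available in a unitRingType, which comes with an inverse *)
(* function; units of an arbitrary ring are defined directly.                  *)
Definition is_unit (S : nzRingType) (u : S) : Prop :=
  exists v : S, v * u = 1 /\ u * v = 1.

Definition is_nilpotent (S : nzRingType) (x : S) : Prop :=
  exists n : nat, x ^+ n = 0.

Definition UU_ring (S : nzRingType) : Prop :=
  forall u : S, is_unit u <-> exists2 x : S, is_nilpotent x & u = 1 + x.

Section Groups.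
Variable G : groupType.
Local Open Scope group_scope.

(* fingroup's #[g] only covers finite groups.                                  *)
Definition has_order (g : G) (n : nat) : Prop :=
  [/\ (0 < n)%N, g ^+ n = 1 & forall m : nat, (0 < m)%N -> g ^+ m = 1 -> (n <= m)%N].

Definition two_group : Prop :=
  forall g : G, exists k : nat, has_order g (2 ^ k)%N.

Definition is_subgroup (H : G -> Prop) : Prop :=
  [/\ H 1, forall x y, H x -> H y -> H (x * y) & forall x, H x -> H x^-1].

Definition generated_by (s : seq G) (x : G) : Prop :=
  forall H : G -> Prop, is_subgroup H -> (forall y, y \in s -> H y) -> H x.

Definition finitely_generated (H : G -> Prop) : Prop :=
  exists s : seq G, forall x, H x <-> generated_by s x.

Definition is_finite (H : G -> Prop) : Prop :=
  exists s : seq G, forall x, H x -> x \in s.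

Definition locally_finite : Prop :=
  forall H : G -> Prop, is_subgroup H -> finitely_generated H -> is_finite H.

End Groups.

(* Main.v *)
(* If [RG] is UU, then [-1] and every [g] are units, so [2] and [g - 1] are     *)
(* nilpotent; expanding [(1 + (g - 1)) ^ (2 ^ N)] binomially gives             *)
(* [g ^ (2 ^ N) = 1] for large [N].  Conversely, the support of a unit [u]     *)
(* lies in a finite 2-group [H], and since [aug u - 1] is nilpotent some power *)
(* of [u - 1] lies in the augmentation ideal of [RH].  As [2] is nilpotent,    *)
(* every element of that ideal is nilpotent, by induction on [|H|]: for [z]    *)
(* central of order 2, a power of it is killed in [R(H/<z>)] by induction,     *)
(* hence is a multiple of the central element [1 - z], which is nilpotent      *)
(* because [(1 - z)^2 = 2 (1 - z)].                                            *)
Require Import Defs.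
From HB Require Import structures.
From mathcomp Require Import all_boot all_fingroup all_solvable all_algebra.
From mathcomp Require Import finmap monalg.
From Stdlib Require Import Classical.

Set Implicit Arguments.
Unset Strict Implicit.
Unset Printing Implicit Defensive.

Import GRing.Theory.

Local Open Scope ring_scope.

(** UU means that [u - 1] is nilpotent for every unit [u] ([UU_ringP]). Necessity uses
    [expr_2pow_eq1] on group elements, and the maps [gr_const] and [aug], which make [R] a retract
    of [RG]. For sufficiency, [finite_subgroup_embedding] and [finite_support_lift] move a unit to
    the group ring of a finite 2-group, whose augmentation ideal is nil by [aug_kernel_nilpotent];
    the induction there rests on [gr_map_kernel] and [one_sub_involution_nilpotent]. *)

(** * Nilpotents and units in a ring *)

Section Nilpotent.
Variable S : nzRingType.
Implicit Types x y c : S.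

Lemma expr_eq0_leq x m n : (m <= n)%N -> x ^+ m = 0 -> x ^+ n = 0.
Proof. by move=> /subnKC <- xm; rewrite exprD xm mul0r. Qed.

Lemma nilpotentN x : is_nilpotent x -> is_nilpotent (- x).
Proof. by case=> n xn; exists n; rewrite exprNn xn mulr0. Qed.

Lemma nilpotent_of_expr x n : is_nilpotent (x ^+ n) -> is_nilpotent x.
Proof. by case=> m xm; exists (n * m)%N; rewrite exprM. Qed.

Lemma nilpotent_comm_mulr c x :
  GRing.comm c x -> is_nilpotent x -> is_nilpotent (c * x).
Proof. by move=> cx [n xn]; exists n; rewrite exprMn_comm // xn mulr0. Qed.

(** The inverse is the geometric series in [- x], which is finite and commutes with [1 + x]. *)
Lemma add1_nilpotent_unit x : is_nilpotent x -> is_unit (1 + x).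
Proof.
move=> /nilpotentN [n xn]; exists (\sum_(i < n) (- x) ^+ i).
have e : (1 + x) * (\sum_(i < n) (- x) ^+ i) = 1.
  by apply/oppr_inj; rewrite -mulNr opprD addrC -subrX1 xn sub0r.
split=> //; rewrite -[RHS]e.
apply/esym/commr_sum => i _; apply: commrX.
by apply/commr_sym; rewrite /GRing.comm mulNr mulrN mulrDl mulrDr mul1r mulr1.
Qed.

Lemma UU_ringP :
  UU_ring S <-> forall x, is_unit x -> is_nilpotent (x - 1).
Proof.
split=> [uu x /uu [y ny ->]|uu x]; first by rewrite addrC addKr.
split=> [/uu nx|[y ny ->]]; last exact: add1_nilpotent_unit.
by exists (x - 1); rewrite // addrC subrK.
Qed.

(** The unit [-1] makes [-1 - 1] nilpotent. *)
Lemma UU_ring_nilpotent2 : UU_ring S -> is_nilpotent (2%:R : S).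
Proof.
move=> /UU_ringP uu; rewrite -[2%:R]opprK; apply: nilpotentN.
by rewrite opprD; apply: uu; exists (-1); rewrite mulrNN mulr1.
Qed.

(* For [0 < i < m] the binomial ['C(2 ^ (n + m), i)] is divisible by [2 ^ n],  *)
(* because [i * 'C(2 ^ N, i) = 2 ^ N * 'C(2 ^ N - 1, i - 1)].                  *)
Lemma expr_2pow_eq1 x :
    is_nilpotent (2%:R : S) -> is_nilpotent (x - 1) ->
  exists N, x ^+ (2 ^ N) = 1.
Proof.
case=> n n2 [m xm]; exists (n + m)%N.
rewrite -[x in LHS](subrK 1) exprD1n.
rewrite big_ord_recl /= expr0 bin0 big1 ?addr0 // => -[i /= lt_i] _; rewrite /bump /= add1n.
case: (leqP m i.+1) => [le_m|lt_m]; first by rewrite (expr_eq0_leq le_m) // mul0rn.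
suff /dvdnP [k ->] : (2 ^ n %| 'C(2 ^ (n + m), i.+1))%N.
  by rewrite -mulr_natr natrM natrX n2 !mulr0.
have C_gt0 : (0 < 'C(2 ^ (n + m), i.+1))%N.
  by rewrite bin_gt0.
(* In 2-adic valuations: the product of [i.+1] and the binomial has at least [n + m], and [i.+1] has
   less than [i.+1 < m], which leaves at least [n] for the binomial. *)
have := dvdn_mulr 'C((2 ^ (n + m)).-1, i) (dvdnn (2 ^ (n + m))).
rewrite mul_bin_diag pfactor_dvdn ?muln_gt0 // lognM //.
rewrite pfactor_dvdn // => le_nm; rewrite -(leq_add2r m) (leq_trans le_nm) //.
rewrite addnC leq_add2l.
by rewrite -ltnS (leq_trans _ (leq_trans lt_m _)) // ltnS ltnW // ltn_logl.
Qed.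

End Nilpotent.

Lemma nilpotent_rmorph (S T : nzRingType) (f : {rmorphism S -> T}) x :
  is_nilpotent x -> is_nilpotent (f x).
Proof. by case=> n xn; exists n; rewrite -rmorphXn xn rmorph0. Qed.

Lemma unit_rmorph (S T : nzRingType) (f : {rmorphism S -> T}) u :
  is_unit u -> is_unit (f u).
Proof.
by case=> v [vu uv]; exists (f v); rewrite -!rmorphM vu uv rmorph1.
Qed.

(** * Maps out of a group ring *)

Section Extension.
Variables (R : nzRingType) (G : groupType) (V : zmodType).
Implicit Types a b : group_ring R G.

Lemma gr_sumE a : a = \sum_(g <- msupp a) (<< a@_g *g g >> : group_ring R G).
Proof. exact: monalgE. Qed.

Lemma gr_additive_eq_in (p q : {additive group_ring R G -> V}) a :
    (forall r g, g \in msupp a -> p << r *g g >> = q << r *g g >>) ->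
  p a = q a.
Proof.
move=> pq; rewrite [a in LHS]gr_sumE [a in RHS]gr_sumE !raddf_sum.
by rewrite big_seq [RHS]big_seq; apply: eq_bigr => g /pq.
Qed.

Lemma gr_additive_eq (p q : {additive group_ring R G -> V}) :
  (forall r g, p << r *g g >> = q << r *g g >>) -> p =1 q.
Proof. by move=> pq a; apply: gr_additive_eq_in. Qed.

Variable F : G -> {additive R -> V}.

(** Universal property of [RG] as a direct sum of copies of [R] indexed by [G]; it yields both [aug]
    and [gr_map]. *)
Definition gr_ext a : V := \sum_(g <- msupp a) F g a@_g.

Lemma gr_extEw a (A : {fset G}) :
  (msupp a `<=` A)%fset -> gr_ext a = \sum_(g <- A) F g a@_g.
Proof.
move=> sA; rewrite /gr_ext (big_fset_incl _ sA) // => g _ /mcoeff_outdom ->.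
exact: raddf0.
Qed.

Lemma gr_extU r g : gr_ext << r *g g >> = F g r.
Proof. by rewrite (gr_extEw msuppU_le) big_seq_fset1 mcoeffUU. Qed.

Fact gr_ext_is_additive : {morph gr_ext : a b / a - b}.
Proof.
move=> a b; rewrite (gr_extEw (msuppB_le a b)).
rewrite (gr_extEw (fsubsetUl _ (msupp b))) (gr_extEw (fsubsetUr (msupp a) _)).
by rewrite -sumrB; apply: eq_bigr => g _; rewrite mcoeffB raddfB.
Qed.

HB.instance Definition _ :=
  GRing.isZmodMorphism.Build (group_ring R G) V gr_ext gr_ext_is_additive.

End Extension.

Section RingExtension.
Variables (R : nzRingType) (G : groupType) (S : nzRingType).
Implicit Types a b : group_ring R G.

Lemma gr_mulU (r s : R) (g h : G) :
  (<< r *g g >> : group_ring R G) * << s *g h >> = << r * s *g (g * h)%g >>.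
Proof. exact: gr_mulUU. Qed.

Lemma gr_mulr_ext (p : {additive group_ring R G -> S}) :
    (forall r s g h, p << r * s *g (g * h)%g >> = p << r *g g >> * p << s *g h >>) ->
  {morph p : a b / a * b}.
Proof.
move=> pM a b; rewrite [a]gr_sumE [b]gr_sumE.
rewrite mulr_suml !raddf_sum mulr_suml; apply: eq_bigr => g _.
rewrite mulr_sumr raddf_sum mulr_sumr; apply: eq_bigr => h _.
by rewrite gr_mulU pM.
Qed.

End RingExtension.

Section Augmentation.
Variables (R : nzRingType) (G : groupType).

Definition aug : group_ring R G -> R := gr_ext (fun=> idfun).

HB.instance Definition _ := GRing.Additive.on aug.

Lemma augU r g : aug << r *g g >> = r.
Proof. exact: gr_extU. Qed.

Fact aug_is_monoid_morphism : monoid_morphism aug.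
Proof. by split; [exact: augU | apply: gr_mulr_ext => *; rewrite /= !augU]. Qed.

HB.instance Definition _ :=
  GRing.isMonoidMorphism.Build (group_ring R G) R aug aug_is_monoid_morphism.

Definition gr_const (r : R) : group_ring R G := << r *g 1%g >>.

Fact gr_const_is_additive : {morph gr_const : x y / x - y}.
Proof. exact: monalgUB. Qed.

HB.instance Definition _ :=
  GRing.isZmodMorphism.Build R (group_ring R G) gr_const gr_const_is_additive.

Fact gr_const_is_monoid_morphism : monoid_morphism gr_const.
Proof. by split=> // r s; rewrite /gr_const gr_mulU mulg1. Qed.

HB.instance Definition _ :=
  GRing.isMonoidMorphism.Build R (group_ring R G) gr_const
    gr_const_is_monoid_morphism.

Lemma aug_const : cancel gr_const aug.
Proof. by move=> r; rewrite /gr_const augU. Qed.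

Definition gr_elt (g : G) : group_ring R G := << 1 *g g >>.

Lemma gr_eltM g h : gr_elt (g * h)%g = gr_elt g * gr_elt h.
Proof. by rewrite /gr_elt gr_mulU mulr1. Qed.

Lemma gr_eltX g n : gr_elt (g ^+ n)%g = gr_elt g ^+ n.
Proof. by elim: n => // n IH; rewrite expgS gr_eltM IH exprS. Qed.

Lemma gr_elt_inj : injective gr_elt.
Proof.
move=> g h /(congr1 (mcoeff h)); rewrite /gr_elt !mcoeffU eqxx.
by case: (g =P h) => // _ /esym/eqP; rewrite oner_eq0.
Qed.

Lemma gr_elt_unit g : is_unit (gr_elt g).
Proof. by exists (gr_elt g^-1); rewrite -!gr_eltM mulVg mulgV. Qed.

Lemma gr_elt_comm z a : (forall g, commute g z) -> GRing.comm a (gr_elt z).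
Proof.
move=> cz; rewrite /GRing.comm [a]gr_sumE mulr_suml mulr_sumr.
by apply: eq_bigr => g _; rewrite !gr_mulU mulr1 mul1r cz.
Qed.

End Augmentation.

Section Functoriality.
Variables (R : nzRingType) (G H : groupType) (f : G -> H).

(** Additive for an arbitrary function [f], so that it also applies to set-theoretic sections. *)
Definition gr_map : group_ring R G -> group_ring R H :=
  gr_ext (fun g => @mkmalgU H R (f g)).

HB.instance Definition _ := GRing.Additive.on gr_map.

Lemma gr_mapU r g : gr_map << r *g g >> = << r *g f g >>.
Proof. exact: gr_extU. Qed.

Lemma aug_map a : aug (gr_map a) = aug a.
Proof.
rewrite -[LHS]/((@aug R H \o gr_map) a).
by apply: gr_additive_eq => r g; rewrite /= gr_mapU !augU.
Qed.

Hypothesis fM : {morph f : x y / (x * y)%g}.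

Lemma gr_mapM : {morph gr_map : a b / a * b}.
Proof. by apply: gr_mulr_ext => *; rewrite /= !gr_mapU gr_mulU fM. Qed.

Lemma gr_map1 : gr_map 1 = 1.
Proof.
rewrite [LHS]gr_mapU; congr << _ *g _ >>.
by apply: (mulgI (f 1%g)); rewrite -fM !mulg1.
Qed.

Lemma gr_mapX n : {morph gr_map : a / a ^+ n}.
Proof.
by move=> a; elim: n => [|n IH]; rewrite ?gr_map1 // !exprS gr_mapM IH.
Qed.

End Functoriality.

(** * The augmentation ideal of a finite 2-group *)

Lemma gr_nilpotent2 (R : nzRingType) (G : groupType) :
  is_nilpotent (2%:R : R) -> is_nilpotent (2%:R : group_ring R G).
Proof.
by rewrite -(rmorph_nat (@gr_const R G)); exact: nilpotent_rmorph.
Qed.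

Lemma one_sub_involution_nilpotent (S : nzRingType) (z : S) :
  is_nilpotent (2%:R : S) -> z ^+ 2 = 1 -> is_nilpotent (1 - z).
Proof.
move=> n2 z2; apply: (@nilpotent_of_expr _ _ 2).
suff -> : (1 - z) ^+ 2 = (1 - z) * 2%:R.
  by apply: nilpotent_comm_mulr => //; exact: commr_nat.
by rewrite mulr_natr expr2 mulrBr mulr1 mulrBl mul1r -expr2 z2 opprB mulr2n.
Qed.

(* For [Q = G/<z>] with [z] of order 2 and [s] a choice of coset               *)
(* representatives, this says that the kernel of [RG -> RQ] is [RG (1 - z)].   *)
Lemma gr_map_kernel (R : nzRingType) (G Q : groupType) (q : G -> Q) (s : Q -> G)
    (z : G) (a : group_ring R G) :
    (forall g, s (q g) = g \/ s (q g) = (g * z)%g) -> gr_map q a = 0 ->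
  exists c, a = c * (1 - gr_elt R z).
Proof.
move=> sq qa0.
(* This holds for every [a] and is checked on monomials: the difference is [0] or
   [r g - r g z = r g (1 - z)]. *)
suff [c ac] : exists c, a - gr_map s (gr_map q a) = c * (1 - gr_elt R z).
  by exists c; rewrite -ac qa0 !raddf0 addr0.
rewrite [a]gr_sumE; elim: (msupp a : seq _) => [|g r [c IH]].
  by exists 0; rewrite big_nil !raddf0 addr0 mul0r.
rewrite big_cons !raddfD /= !gr_mapU addrACA IH.
suff [d ->] : exists d, << a@_g *g g >> - << a@_g *g s (q g) >>
                        = d * (1 - gr_elt R z).
  by exists (d + c); rewrite mulrDl.
case: (sq g) => ->; first by exists 0; rewrite subrr mul0r.
by exists << a@_g *g g >>; rewrite mulrBr mulr1 gr_mulU mulr1.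
Qed.

Lemma aug_kernel_nilpotent (R : nzRingType) (gT : finGroupType)
    (a : group_ring R gT) :
    is_nilpotent (2%:R : R) -> (2.-group [set: gT])%g -> aug a = 0 ->
  is_nilpotent a.
Proof.
(* Induction on a bound for the order, as the group type changes in the quotient. *)
move=> n2; move: {2}#|_| (leqnn #|gT|) => n.
elim: n => [|n IH] in gT a *; first by rewrite leqNgt -cardsT cardG_gt0.
move=> le_n pG a0.
have [/eqP tG|ntG] := boolP ([set: gT] == 1)%g.
  (* Over the trivial group, [a] is the constant [aug a], that is, 0. *)
  exists 1%N; rewrite expr1 -[a]/(idfun a) -(raddf0 (@gr_const R gT)) -a0.
  rewrite -[RHS]/((@gr_const R gT \o @aug R gT) a).
  apply: gr_additive_eq => r g /=; rewrite augU /gr_const.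
  by congr << _ *g _ >>; apply/set1gP; rewrite -tG inE.
have [] := @Cauchy _ 2 'Z([set: gT])%G isT.
  have ntZ : 'Z([set: gT])%G :!=: 1%g by rewrite center_nil_eq1 ?(pgroup_nil pG).
  by have [] := pgroup_pdiv (pgroupS (center_sub _) pG) ntZ.
move=> z /setIP[_ /centP zC] oz.
have cz (g : gT) : commute g z by apply/commute_sym/zC; rewrite inE.
(* [coset] is a morphism only on the normalizer, which is everything since [z] is central. *)
have nzT (g : gT) : g \in 'N(<[z]>)%g.
  by rewrite (subsetP (cent_sub _)) // cent_cycle; apply/cent1P.
have qM : {morph coset <[z]>%g : x y / (x * y)%g} by move=> x y; rewrite morphM.
have [m am] : is_nilpotent (gr_map (coset <[z]>%g) a).
  apply: IH.
  - rewrite -ltnS (leq_trans _ le_n) // -cardsT -quotientT -[X in (_ < X)%N]cardsT.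
    by rewrite ltn_quotient ?subsetT // -cardG_gt1 -orderE oz.
  - by rewrite -quotientT quotient_pgroup.
  - by rewrite aug_map.
apply: (@nilpotent_of_expr _ _ m).
have sq g : repr (coset <[z]>%g g) = g \/ repr (coset <[z]>%g g) = (g * z)%g.
  have := mem_repr_coset (coset <[z]>%g g); rewrite val_coset // => /rcosetP[y].
  rewrite /= (cycle2g oz) !inE => /orP[]/eqP-> ->; first by left; rewrite mul1g.
  by right; rewrite cz.
have [|c ->] :=
    @gr_map_kernel R gT _ _ (fun x : coset_of <[z]> => repr x) z (a ^+ m) sq.
  by rewrite gr_mapX.
apply: nilpotent_comm_mulr.
  apply: commrB; first exact: commr1.
  exact: gr_elt_comm.
apply: one_sub_involution_nilpotent; first exact: gr_nilpotent2.
by rewrite -gr_eltX -oz expg_order.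
Qed.

(** * Orders of elements and reduction to finite groups *)

Lemma has_order_dvd (G : groupType) (g : G) n :
  (0 < n)%N -> (g ^+ n = 1)%g -> exists2 k, has_order g k & (k %| n)%N.
Proof.
move=> n_gt0 gn.
have exk : exists k, (0 < k)%N && (g ^+ k == 1)%g by exists n; rewrite n_gt0 gn eqxx.
case: (ex_minnP exk) => k /andP[k_gt0 /eqP gk] k_min; exists k.
  by split=> // m m_gt0 gm; apply: k_min; rewrite m_gt0 gm eqxx.
rewrite /dvdn -leqn0 leqNgt; apply/negP => r_gt0.
have /k_min : (0 < n %% k)%N && (g ^+ (n %% k) == 1)%g.
  rewrite r_gt0 /=; move: gn; rewrite {1}(divn_eq n k) expgnDr mulnC expgM gk.
  by rewrite expg1n mul1g => ->.
by rewrite leqNgt ltn_pmod.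
Qed.

Lemma finite_subgroup_embedding (G : groupType) (H : G -> Prop) :
    is_subgroup H -> Defs.is_finite H ->
  exists (gT : finGroupType) (f : gT -> G),
    [/\ injective f, {morph f : x y / (x * y)%g}
      & forall x, H x <-> exists y, f y = x].
Proof.
case=> H1 HM HV [s sH].
(* The list [s] may exceed [H], an arbitrary predicate; excluded middle filters it. *)
have [t tH] : exists t : seq G, forall x, x \in t <-> H x.
  suff [t tH] : exists t : seq G, forall x, x \in t <-> H x /\ x \in s.
    by exists t => x; split=> [/tH[]|Hx] //; apply/tH; split=> //; exact: sH.
  elim: s {sH} => [|y s [t tH]]; first by exists [::] => x; split=> [|[]].
  have [Hy|nHy] := classic (H y).
    exists (y :: t) => x; rewrite !inE; split.
      by case/orP=> [/eqP->|/tH[Hx ->]]; rewrite ?eqxx ?orbT.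
    by case=> Hx /orP[->//|xs]; apply/orP; right; apply/tH.
  exists t => x; rewrite inE; split=> [/tH[Hx ->]|[Hx /orP[/eqP xy|xs]]].
  - by rewrite orbT.
  - by case: nHy; rewrite -xy.
  - exact/tH.
pose T := seq_sub t.
have TH (x : T) : H (val x) by apply/tH; exact: valP.
pose mulT (x y : T) : T := Sub (val x * val y)%g ((tH _).2 (HM _ _ (TH x) (TH y))).
pose oneT : T := Sub 1%g ((tH _).2 H1).
pose invT (x : T) : T := Sub (val x)^-1%g ((tH _).2 (HV _ (TH x))).
have mulTA : associative mulT by move=> x y w; apply/val_inj; rewrite /= mulgA.
have mul1T : left_id oneT mulT by move=> x; apply/val_inj; rewrite /= mul1g.
have mulVT : left_inverse oneT invT mulT.
  by move=> x; apply/val_inj; rewrite /= mulVg.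
pose gT : finGroupType := HB.pack T (Finite_isGroup.Build T mulTA mul1T mulVT).
exists gT, (val : T -> G); split=> [|//|x]; first exact: val_inj.
split=> [/tH xt|[y <-]]; [by exists (Sub x xt : T) | exact: TH].
Qed.

Lemma generated_subgroup (G : groupType) (s : seq G) :
  is_subgroup (generated_by s).
Proof.
split=> [H [] //|x y sx sy H|x sx H] HG Hs; case: (HG) => H1 HM HV.
  by apply: HM; [exact: sx | exact: sy].
by apply: HV; exact: sx.
Qed.

(** By Cauchy, a prime divisor [p] of the order is the order of some [x]; a power of 2 kills [x], so
    [p = 2]. *)
Lemma two_group_finite (G : groupType) (gT : finGroupType) (f : gT -> G) :
    injective f -> {morph f : x y / (x * y)%g} -> two_group G ->
  (2.-group [set: gT])%g.
Proof.
move=> f_inj fM G2; apply/pgroupP => p p_pr /(Cauchy p_pr)[x _ ox].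
have f1 : f 1%g = 1%g by apply: (mulgI (f 1%g)); rewrite -fM !mulg1.
have fX n : f (x ^+ n)%g = (f x ^+ n)%g.
  by elim: n => // n IH; rewrite !expgS fM IH.
have [k [_ fxk _]] := G2 (f x).
have /eqP : (x ^+ (2 ^ k) = 1)%g by apply: f_inj; rewrite fX fxk f1.
by rewrite -order_dvdn ox Euclid_dvdX // => /andP[]; rewrite dvdn_prime2.
Qed.

Lemma finite_support_lift (R : nzRingType) (G H : groupType) (f : H -> G)
    (s : G -> H) (u : group_ring R G) :
  {in msupp u, cancel s f} -> gr_map f (gr_map s u) = u.
Proof.
move=> sK; rewrite -[LHS]/((@gr_map R H G f \o gr_map s) u) -[RHS]/(idfun u).
by apply: gr_additive_eq_in => r g /sK gK; rewrite /= !gr_mapU gK.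
Qed.

Theorem theorem2p22 (R : nzRingType) (G : groupType) :
  (UU_ring (group_ring R G) -> UU_ring R /\ two_group G)
  /\ (locally_finite G -> two_group G -> UU_ring R -> UU_ring (group_ring R G)).
Proof.
split=> [uu | lfG G2 /[dup] /UU_ring_nilpotent2 n2 /UU_ringP uu].
  have n2 := UU_ring_nilpotent2 uu; move/UU_ringP: uu => uu; split.
    apply/UU_ringP => x /(@unit_rmorph _ _ (@gr_const R G)) /uu.
    move/(@nilpotent_rmorph _ _ (@aug R G)).
    by rewrite rmorphB rmorph1 /= aug_const.
  move=> g; have [N] := expr_2pow_eq1 n2 (uu _ (gr_elt_unit R g)).
  rewrite -gr_eltX => /gr_elt_inj gN.
  have [|k ok] := has_order_dvd _ gN; first by rewrite expn_gt0.
  by case/dvdn_pfactor=> // m _ km; exists m; rewrite -km.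
apply/UU_ringP => u uU.
pose H := generated_by (msupp u).
have HG : is_subgroup H := generated_subgroup _.
have [|gT [f [f_inj fM Hf]]] := finite_subgroup_embedding HG.
  by apply: lfG => //; exists (msupp u).
(* A partial inverse of [f], with value 1 off its image, which contains the support of [u]. *)
pose s x := odflt 1%g [pick y | f y == x].
have sK : {in msupp u, cancel s f}.
  move=> x xu; rewrite /s; case: pickP => [y /eqP //|no].
  have /Hf [y yx] : H x by move=> K _; apply.
  by have := no y; rewrite yx eqxx.
have [n un] : is_nilpotent (aug u - 1) by apply/uu/(@unit_rmorph _ _ (@aug R G)).
(* [gr_map s] is additive and preserves augmentations, so the [n]-th power of [gr_map s u - 1] has
   augmentation [(aug u - 1) ^+ n = 0]. The multiplicative map [gr_map f] then carries nilpotence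
   back to [u - 1]. *)
have [m um] : is_nilpotent (gr_map s u - 1).
  apply: (@nilpotent_of_expr _ _ n); apply: aug_kernel_nilpotent => //.
    exact: two_group_finite f_inj fM G2.
  by rewrite rmorphXn rmorphB rmorph1 /= aug_map.
exists m; rewrite -[u](finite_support_lift sK) -(gr_map1 R fM) -raddfB.
by rewrite -gr_mapX // um raddf0.
Qed.
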